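(* For every $n\ge 1$, the semigroup $O_n$ is closed in $T_n$, i.e. $\mathrm{Dom}_{T_n}(O_n)=O_n$.
   Context: $X_n=\{1,2,\dots,n\}$ is the finite chain with its usual order, and $T_n$ is the full transformation semigroup of all maps $X_n\to X_n$, written on the right and composed left to right. $O_n=\{\alpha\in T_n: x\le y\Rightarrow x\alpha\le y\alpha \text{ for all } x,y\in X_n\}$ is the subsemigroup of order-preserving maps. For a subsemigroup $U$ of a semigroup $S$, an element $d\in S$ is dominated by $U$ if for every semigroup $T$ and all semigroup homomorphisms $f,g:S\to T$ with $f|_U=g|_U$ one has $(d)f=(d)g$; the dominion $\mathrm{Dom}_S(U)$ is the set of all elements of $S$ dominated by $U$ (a subsemigroup of $S$ containing $U$). $U$ is closed in $S$ if $\mathrm{Dom}_S(U)=U$. *)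

(* Defs.v *)
From HB Require Import structures.
From mathcomp Require Import all_boot monoid.
From mathcomp Require Import boolp classical_sets.

Set Implicit Arguments.
Unset Strict Implicit.
Unset Printing Implicit Defensive.

Import Algebra.
Local Open Scope group_scope.
Local Open Scope classical_set_scope.

(* The choiceType structure bundled in semigroupType excludes no semigroup:
   classically every type carries one. *)
Definition dominion (S : semigroupType) (U : mulgClosed S) : set S :=
  [set d | forall (T : semigroupType) (f g : {multiplicative S -> T}),
      {in U, f =1 g} -> f d = g d].

Definition closed_in (S : semigroupType) (U : mulgClosed S) : Prop :=
  dominion U = [set` U].

(* The chain 1 < ... < n is 'I_n, i.e. shifted to 0 < ... < n - 1. The alias
   keeps composition apart from the pointwise product that the library puts
   on finite functions. *)
Definition transf (n : nat) : Type := {ffun 'I_n -> 'I_n}.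

HB.instance Definition _ n := Finite.copy (transf n) {ffun 'I_n -> 'I_n}.

(* Maps act on the right: x (a b) = (x a) b. *)
Definition transf_mul n (a b : transf n) : transf n := [ffun x => b (a x)].

Fact transf_mulA n : associative (@transf_mul n).
Proof. by move=> a b c; apply/ffunP => x; rewrite !ffunE. Qed.

HB.instance Definition _ n := isSemigroup.Build (transf n) (@transf_mulA n).

Lemma transfME n (a b : transf n) x : (a * b) x = b (a x).
Proof. by rewrite ffunE. Qed.

Definition order_preserving n : {pred transf n} :=
  fun a => [forall x : 'I_n, forall y : 'I_n, (x <= y) ==> (a x <= a y)].
Arguments order_preserving : clear implicits.

Lemma order_preservingP n (a : transf n) :
  reflect {homo a : x y / x <= y} (a \in order_preserving n).
Proof.
apply: (iffP forallP) => [h x y le_xy | h x].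
  exact: (implyP (forallP (h x) y)).
by apply/forallP => y; apply/implyP; apply: h.
Qed.

Fact order_preservingM n : mulg_closed (order_preserving n).
Proof.
move=> a b /order_preservingP ha /order_preservingP hb.
by apply/order_preservingP => x y le_xy; rewrite !transfME; apply/hb/ha.
Qed.

HB.instance Definition _ n :=
  isMulClosed.Build (transf n) (order_preserving n) (@order_preservingM n).

(* Main.v *)
From HB Require Import structures.
Require Import Defs.
From mathcomp Require Import all_boot.
From mathcomp Require Import monoid boolp classical_sets.

(** Sorting a pair, (x, y) |-> (min x y, max x y), commutes with the action of
    a map a on pairs exactly when a preserves the order. Over F_2, the sorting
    map m turns into the involution (phi, psi) |-> (phi + psi o m, psi) on
    pairs of functions of pairs. Letting transformations act on such functions
    by precomposition, and comparing this action with its conjugate by the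
    involution, gives two homomorphisms that agree exactly on O_n. *)

Set Implicit Arguments.
Unset Strict Implicit.
Unset Printing Implicit Defensive.

Import Algebra.
Local Open Scope group_scope.

(* The alias keeps composition apart from the pointwise product on functions. *)
Definition selfmap (E : Type) : Type := E -> E.

HB.instance Definition _ E := gen_eqMixin (selfmap E).
HB.instance Definition _ E := gen_choiceMixin (selfmap E).

Definition selfmap_mul E (a b : selfmap E) : selfmap E := a \o b.

Fact selfmap_mulA E : associative (@selfmap_mul E).
Proof. by []. Qed.

HB.instance Definition _ E := isSemigroup.Build (selfmap E) (@selfmap_mulA E).

(** Since [c] is an involution, [c \o act s \o c] is multiplicative in [s], and it equals [act s]
    exactly when [act s] commutes with [c]. Both homomorphisms thus agree on [U], hence at [d]. *)
Lemma dominion_commutes (S : semigroupType) (U : mulgClosed S) (E : Type)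
    (act : S -> E -> E) (c : E -> E) (d : S) :
    (forall a b, act (a * b) = act a \o act b) -> involutive c ->
    {in U, forall u, act u \o c = c \o act u} ->
  dominion U d -> act d \o c = c \o act d.
Proof.
move=> actM cK cU domd.
pose conj s : selfmap E := c \o act s \o c.
have conjM : {morph conj : a b / a * b}.
  by move=> a b; apply/funext => x; rewrite /conj actM /= /mul /= /selfmap_mul /= cK.
pose f : {multiplicative S -> selfmap E} :=
  HB.pack (act : S -> selfmap E) (isMultiplicative.Build S (selfmap E) act actM).
pose g : {multiplicative S -> selfmap E} :=
  HB.pack conj (isMultiplicative.Build S (selfmap E) conj conjM).
have /(domd _ f g) fg_d : {in U, f =1 g}.
  move=> u uU; apply/funext => x /=.
  by rewrite /conj -cU //= cK.
apply/funext => x /=.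
have -> : act d (c x) = conj d (c x) by exact: (congr1 (@^~ (c x)) fg_d).
by rewrite /conj /= cK.
Qed.

Definition sort_pair n (p : 'I_n * 'I_n) : 'I_n * 'I_n :=
  if p.1 <= p.2 then p else (p.2, p.1).

Definition pair_act n (a : transf n) (p : 'I_n * 'I_n) : 'I_n * 'I_n :=
  (a p.1, a p.2).

Lemma sort_pair_act n (a : transf n) : a \in order_preserving n ->
  forall p, sort_pair (pair_act a p) = pair_act a (sort_pair p).
Proof.
move=> /order_preservingP ha [x y]; rewrite /sort_pair /pair_act /=.
case: (leqP x y) => [/ha -> // | /ltnW/ha le_yx] /=.
(* If [a x <= a y] as well, the image pair is not swapped, but its entries coincide. *)
case: leqP => // le_xy.
by have -> : a x = a y by apply/val_inj/eqP; rewrite eqn_leq le_xy.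
Qed.

Lemma sort_pair_act_order_preserving n (a : transf n) :
  (forall p, sort_pair (pair_act a p) = pair_act a (sort_pair p)) ->
  a \in order_preserving n.
Proof.
move=> sort_a; apply/order_preservingP => x y le_xy.
move: (sort_a (x, y)); rewrite /sort_pair /pair_act /= le_xy /=.
(* If [a y < a x], sorting swaps the image pair, which forces [a y = a x]. *)
by case: leqP => // lt_yx [eq_yx _]; rewrite eq_yx ltnn in lt_yx.
Qed.

Definition shear T (m : T -> T) (v : (T -> bool) * (T -> bool)) :=
  ((fun p => v.1 p (+) v.2 (m p)), v.2).

Lemma shearK T (m : T -> T) : involutive (shear m).
Proof.
move=> [phi psi]; rewrite /shear /=; congr (_, _).
by apply/funext => p; rewrite -addbA addbb addbF.
Qed.

Definition precomp T (h : T -> T) (v : (T -> bool) * (T -> bool)) :=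
  (v.1 \o h, v.2 \o h).

Lemma precomp_shear T (h m : T -> T) :
  precomp h \o shear m = shear m \o precomp h <-> (forall p, m (h p) = h (m p)).
Proof.
split=> [hm p | hm].
  (* The first components differ only in [psi (m (h p))] versus [psi (h (m p))]; the indicator of
     the point [h (m p)] separates these arguments. *)
  pose psi q := `[< q = h (m p) >].
  have /= eq_psi : psi (m (h p)) = psi (h (m p)).
    exact: (congr1 (fun F => (F (xpred0, psi)).1 p) hm).
  by apply/asboolP; rewrite -/(psi _) eq_psi; apply/asboolP.
apply/funext => -[phi psi]; rewrite /precomp /shear /=; congr (_, _).
by apply/funext => p /=; rewrite hm.
Qed.

Theorem proposition3p2 (n : nat) (hn : 1 <= n) :
  closed_in (order_preserving n).
Proof.
apply/seteqP; split=> [d domd | d dU T f g fgU]; last exact: fgU.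
apply/sort_pair_act_order_preserving/precomp_shear.
apply: (dominion_commutes (act := fun a => precomp (pair_act a)) _ _ _ domd).
(* Precomposition reverses products, and so does writing maps on the right; the two reversals
   cancel. *)
- move=> a b; apply/funext => -[phi psi]; rewrite /precomp /=.
  by congr (_, _); apply/funext => p /=; rewrite /pair_act !transfME.
- exact: shearK.
- by move=> u uU; apply/precomp_shear/sort_pair_act.
Qed.
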